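(* Let $X$ and $Y$ be independent and identically distributed random variables with distribution function $F$ on $\mathbb{R}$, and let $\psi:\mathbb{R}\to\mathbb{R}$ be a measurable function. Then the inequalities $$E_F\Big(\Big|E_F\big(\psi(Y)\{\mathbf 1_{[Y<X]}+\tfrac12\mathbf 1_{[Y=X]}\}\mid X\big)\,\psi(X)\Big|\Big)\le E_F\Big(|\psi(X)\psi(Y)|\{\mathbf 1_{[Y<X]}+\tfrac12\mathbf 1_{[Y=X]}\}\Big)\le \tfrac12E_F\big(\psi^2(X)\big)\qquad(1)$$ and $$E_F\Big(\Big|E_F\big(\psi(Y)\{\mathbf 1_{[Y>X]}+\tfrac12\mathbf 1_{[Y=X]}\}\mid X\big)\,\psi(X)\Big|\Big)\le E_F\Big(|\psi(X)\psi(Y)|\{\mathbf 1_{[Y>X]}+\tfrac12\mathbf 1_{[Y=X]}\}\Big)\le \tfrac12E_F\big(\psi^2(X)\big)\qquad(2)$$ hold. Moreover, in each of the chains (1) and (2), equality holds throughout (both inequalities are equalities) if and only if $\psi$ is constant $F$-almost everywhere.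
   Context: The distribution function is $F(x)=P_F(X\le x)$, $x\in\mathbb{R}$ (it may have atoms); $P_F$ and $E_F$ denote probability and expectation when the random variables have distribution function $F$. $\mathbf 1_{[\cdot]}$ denotes an indicator. The conditional expectation given $X=x$ is $$E_F\big(\psi(Y)\{\mathbf 1_{[Y<X]}+\tfrac12\mathbf 1_{[Y=X]}\}\mid X=x\big)=\int_{-\infty}^{\infty}\psi(y)\{\mathbf 1_{[y<x]}+\tfrac12\mathbf 1_{[y=x]}\}\,dF(y),$$ and likewise with $<$ replaced by $>$. ''$F$-almost everywhere'' means almost everywhere with respect to the probability measure on $\mathbb{R}$ induced by $F$.
   Formalization: ''Equality holds throughout'' is taken to mean that the three terms are equal and finite; with infinite values allowed the ''only if'' fails, e.g. for F uniform on (0,1) and ψ(x)=1/x all three terms are +∞ but ψ is not constant. *)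

(* Defs.v *)
From HB Require Import structures.
From mathcomp Require Import all_boot all_order all_algebra.
From mathcomp Require Import all_classical all_reals all_analysis.

Set Implicit Arguments.
Unset Strict Implicit.
Unset Printing Implicit Defensive.

Import Order.TTheory GRing.Theory Num.Theory.
Import numFieldNormedType.Exports.

Local Open Scope classical_set_scope.
Local Open Scope ring_scope.
Local Open Scope ereal_scope.

Definition independent_RVs (d : measure_display) (T : measurableType d)
    (R : realType) (P : probability T R) (X Y : {RV P >-> R}) : Prop :=
  forall A B : set R, measurable A -> measurable B ->
    P (X @^-1` A `&` Y @^-1` B) = P (X @^-1` A) * P (Y @^-1` B).

Definition has_cdf (d : measure_display) (T : measurableType d)
    (R : realType) (P : probability T R) (X : {RV P >-> R}) (F : R -> R) : Prop :=
  forall x : R, cdf X x = (F x)%:E.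

(* The weights 1_[y<x] + 1/2 1_[y=x] and 1_[y>x] + 1/2 1_[y=x], with y first. *)
Definition weight_lt (R : realType) (y x : R) : R :=
  ((y < x)%R%:R + 2^-1 * (y == x)%:R)%R.

Definition weight_gt (R : realType) (y x : R) : R :=
  ((y > x)%R%:R + 2^-1 * (y == x)%:R)%R.

(* E_F(psi(Y) k(Y, X) | X = x). It is extended-real-valued since psi need not
   be F-integrable; where the positive and negative parts both have infinite
   integral, the library's integral is -oo, which has absolute value +oo. *)
Definition cond_mean (R : realType) (F : cumulativeBounded (0 : R) (1 : R))
    (psi : R -> R) (k : R -> R -> R) (x : R) : \bar R :=
  \int[lebesgue_stieltjes_measure F]_y (psi y * k y x)%:E.

Definition mean_abs_cond (d : measure_display) (T : measurableType d)
    (R : realType) (P : probability T R) (X : {RV P >-> R})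
    (F : cumulativeBounded (0 : R) (1 : R))
    (psi : R -> R) (k : R -> R -> R) : \bar R :=
  \int[P]_w `| cond_mean F psi k (X w) * (psi (X w))%:E |.

Definition mean_abs_prod (d : measure_display) (T : measurableType d)
    (R : realType) (P : probability T R) (X Y : {RV P >-> R})
    (psi : R -> R) (k : R -> R -> R) : \bar R :=
  'E_P[fun w => `|psi (X w) * psi (Y w)| * k (Y w) (X w)]%R.

Definition half_mean_sq (d : measure_display) (T : measurableType d)
    (R : realType) (P : probability T R) (X : {RV P >-> R})
    (psi : R -> R) : \bar R :=
  (2^-1)%:E * 'E_P[fun w => (psi (X w) ^+ 2)%R].

Definition ae_constant (R : realType) (F : cumulativeBounded (0 : R) (1 : R))
    (psi : R -> R) : Prop :=
  exists c : R, {ae lebesgue_stieltjes_measure F, forall x, psi x = c}.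

(* Equality of real numbers. Mere equality in the extended reals would allow
   a = b = c = +oo, which does occur for nonconstant psi: for F uniform on
   (0, 1) and psi(x) = 1/x there, all three terms of the chain are +oo. *)
Definition equal_throughout (R : realType) (a b c : \bar R) : Prop :=
  [/\ a = b, b = c & c \is a fin_num].

(* Main.v *)
Require Import Defs.
From HB Require Import structures.
From mathcomp Require Import all_boot all_order all_algebra.
From mathcomp Require Import all_classical all_reals all_analysis.
From mathcomp Require Import measurable_realfun ring lra.

Set Implicit Arguments.
Unset Strict Implicit.
Unset Printing Implicit Defensive.

Import Order.TTheory GRing.Theory Num.Theory.
Import numFieldNormedType.Exports.

Local Open Scope classical_set_scope.
Local Open Scope ring_scope.
Local Open Scope ereal_scope.

(** Write mu for the law of X and Y, m for the mu-integral of |psi|, k y x for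
    either weight and A f x for the integral of f y * k y x over y. Both weights
    come from a total preorder: k y x is positive exactly when y comes no later
    than x, and k y x + k x y = 1. The argument is carried out for any weight of
    this kind on any probability space.

    By independence and Tonelli the three terms of the chain are the integrals
    of |A psi * psi| and of A |psi| * |psi|, and half the integral of psi^2. The
    first inequality is the pointwise bound |A psi| <= A |psi|. For the second,
    exchanging x and y replaces k y x by k x y = 1 - k y x, so the middle term
    is m^2 / 2 ([weighted_mean_symmetrization]), and m^2 is at most the integral
    of psi^2, with defect the variance of |psi| ([second_moment_identity]).

    Suppose now that the three terms are equal and finite. The variance
    vanishes, so |psi| = m almost everywhere. If m = 0 then psi = 0. Otherwise
    |A psi| = A |psi| almost everywhere, that is, at almost every x the positive
    part p or the negative part n of psi has A p x = 0 or A n x = 0. Since k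
    comes from a total preorder, the points where A n vanishes form an initial
    segment, and so do those where A p vanishes. Two initial segments are
    nested, hence one of A p, A n vanishes almost everywhere. The
    symmetrization identity then turns A p = 0 into (int p)^2 = 0, so psi has
    constant sign ([one_signed_of_abs_weighted_mean_eq]) and is m or -m.
    Conversely, a psi of constant sign satisfies |A psi| = A |psi|, and a
    constant |psi| has zero variance. *)

(** * Weights of total preorders *)

Definition weighted_mean d (T : measurableType d) (R : realType)
    (mu : probability T R) (k : T -> T -> R) (f : T -> R) (x : T) : \bar R :=
  \int[mu]_y (f y * k y x)%:E.

(** [0 < k y x] is to be read as y <= x in a total preorder: totality is a
    consequence of the two values of [k] at a pair adding up to 1. *)
Definition comparison_weight d (T : measurableType d) (R : realType)
    (k : T -> T -> R) : Prop :=
  [/\ measurable_fun [set: T * T] (fun z : T * T => k z.1 z.2),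
      forall y x, (0 <= k y x)%R,
      forall y x, (k y x + k x y)%R = 1%R &
      forall y x z, (0 < k y x)%R -> (0 < k x z)%R -> (0 < k y z)%R].

(** * Iterated integrals and almost everywhere equality *)

(** Sections of [f] need not be integrable: the positive and negative parts are
    measurable by Tonelli, and so is their extended difference. *)
Lemma measurable_section_integral d1 d2 (T1 : measurableType d1)
    (T2 : measurableType d2) (R : realType)
    (mu : {sigma_finite_measure set T2 -> \bar R}) (f : T1 * T2 -> \bar R) :
  measurable_fun setT f ->
  measurable_fun setT (fun x => \int[mu]_y f (x, y)).
Proof.
move=> mf.
have -> : (fun x => \int[mu]_y f (x, y)) =
    fubini_F mu f^\+ \- fubini_F mu f^\-.
  apply/funext => x; rewrite integralE.
  under eq_integral do rewrite funepos_comp/=.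
  by under [X in _ - X = _]eq_integral do rewrite funeneg_comp/=.
apply: emeasurable_funB; apply: measurable_fun_fubini_tonelli_F => //.
- exact: measurable_funepos.
- exact: measurable_funeneg.
Qed.

Lemma ge0_iterated_integralD d1 d2 (T1 : measurableType d1)
    (T2 : measurableType d2) (R : realType)
    (mu1 : {measure set T1 -> \bar R})
    (mu2 : {sigma_finite_measure set T2 -> \bar R}) (f g : T1 * T2 -> \bar R) :
  measurable_fun setT f -> measurable_fun setT g ->
  (forall z, 0 <= f z) -> (forall z, 0 <= g z) ->
  \int[mu1]_x \int[mu2]_y (f (x, y) + g (x, y)) =
  \int[mu1]_x \int[mu2]_y f (x, y) + \int[mu1]_x \int[mu2]_y g (x, y).
Proof.
move=> mf mg f0 g0; rewrite -ge0_integralD//.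
- apply: eq_integral => x _; rewrite ge0_integralD//.
  + exact: (measurableT_comp mf (measurable_pair1 x)).
  + exact: (measurableT_comp mg (measurable_pair1 x)).
- by move=> x _; exact: integral_ge0.
- exact: measurable_section_integral.
- by move=> x _; exact: integral_ge0.
- exact: measurable_section_integral.
Qed.

Lemma ge0_iterated_integralM d1 d2 (T1 : measurableType d1)
    (T2 : measurableType d2) (R : realType)
    (mu1 : {measure set T1 -> \bar R}) (mu2 : {measure set T2 -> \bar R})
    (f : T1 -> \bar R) (g : T2 -> \bar R) :
  measurable_fun setT f -> measurable_fun setT g ->
  (forall x, 0 <= f x) -> (forall y, 0 <= g y) ->
  \int[mu1]_x \int[mu2]_y (f x * g y) =
  \int[mu1]_x f x * \int[mu2]_y g y.
Proof.
move=> mf mg f0 g0; rewrite -ge0_integralZr//; last exact: integral_ge0.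
by apply: eq_integral => x _; rewrite ge0_integralZl.
Qed.

(** The function [g - f] is nonnegative with integral 0. Finiteness of [g] at
    every point keeps it away from differences of infinities. *)
Lemma ae_eq_of_le_integral_eq d (T : measurableType d) (R : realType)
    (mu : {measure set T -> \bar R}) (f g : T -> \bar R) :
  measurable_fun [set: T] f -> measurable_fun [set: T] g ->
  (forall x, 0 <= f x) -> (forall x, f x <= g x) -> (forall x, g x < +oo) ->
  \int[mu]_x f x = \int[mu]_x g x -> \int[mu]_x g x < +oo ->
  {ae mu, forall x, f x = g x}.
Proof.
move=> mf mg f0 fg goo ifg igoo.
have g0 x : 0 <= g x by exact: le_trans (f0 x) (fg x).
have ig : mu.-integrable setT g.
  apply/integrableP; split => //.
  by under eq_integral do rewrite gee0_abs//.
have if_ : mu.-integrable setT f.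
  apply: le_integrable ig => // x _.
  by rewrite !gee0_abs.
have ffin x : f x \is a fin_num.
  by rewrite ge0_fin_numE// (le_lt_trans (fg x)).
have gfin x : g x \is a fin_num by rewrite ge0_fin_numE.
have gf0 x : 0 <= (g \- f) x by rewrite sube_ge0// ffin.
have mgf : measurable_fun setT (g \- f) by exact: emeasurable_funB.
have : \int[mu]_x `|(g \- f) x| = 0.
  under eq_integral do rewrite gee0_abs//.
  rewrite integralB// ifg subee// ge0_fin_numE//.
  exact: integral_ge0.
move=> /(ae_eq_integral_abs mu measurableT mgf) [N [mN N0 subN]].
exists N; split => //.
apply: subset_trans subN; apply: subsetC => x /= /(_ I).
move: (gfin x) (ffin x); rewrite /=.
by case: (g x) (f x) => [r| |] [s| |] //= _ _ [] /subr0_eq ->.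
Qed.

(** * Weighted means and symmetrization *)

Section weighted_mean.
Context d (T : measurableType d) (R : realType).
Variable mu : probability T R.

(** The variance formula. It is proved as
    int (f - m)^2 + 2 m^2 = int f^2 + m^2, all of whose terms are nonnegative,
    so that it also holds when [f] is not square integrable. *)
Lemma second_moment_identity (f : T -> R) (m : R) :
  measurable_fun setT f -> (forall x, 0 <= f x)%R ->
  \int[mu]_x (f x)%:E = m%:E ->
  \int[mu]_x ((f x - m) ^+ 2)%:E + (m ^+ 2)%:E = \int[mu]_x (f x ^+ 2)%:E.
Proof.
move=> mf f0 fm.
have m0 : (0 <= m)%R by rewrite -lee_fin -fm integral_ge0// => x _; rewrite lee_fin.
have mfm : measurable_fun setT (fun x => ((f x - m) ^+ 2)%:E).
  by apply/measurable_EFinP/measurable_funX; exact: measurable_funB.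
have H : \int[mu]_x ((f x - m) ^+ 2)%:E + (2 * m * m)%:E =
         \int[mu]_x (f x ^+ 2)%:E + (m ^+ 2)%:E.
  transitivity (\int[mu]_x (((f x - m) ^+ 2)%:E + (2 * m)%:E * (f x)%:E)).
    rewrite ge0_integralD//; first last.
    - by apply: measurable_funeM; exact/measurable_EFinP.
    - by move=> x _; rewrite -EFinM lee_fin !mulr_ge0.
    - by move=> x _; rewrite lee_fin sqr_ge0.
    rewrite ge0_integralZl//; first last.
    - by rewrite lee_fin mulr_ge0.
    - by move=> x _; rewrite lee_fin.
    - exact/measurable_EFinP.
    by rewrite fm.
  transitivity (\int[mu]_x ((f x ^+ 2)%:E + (m ^+ 2)%:E)).
    apply: eq_integral => x _; rewrite -EFinM -!EFinD; congr _%:E; ring.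
  rewrite ge0_integralD//; first last.
  - by move=> x _; rewrite lee_fin sqr_ge0.
  - by apply/measurable_EFinP/measurable_funX.
  - by move=> x _; rewrite lee_fin sqr_ge0.
  by rewrite integral_cst//= probability_setT mule1.
move: H; case: (\int[mu]_x _) => [a| |]; case: (\int[mu]_x _) => [b| |] //=.
by rewrite -!EFinD => -[H]; congr _%:E; lra.
Qed.

Lemma integral_lty_of_sqr (f : T -> R) :
  measurable_fun setT f -> (forall x, 0 <= f x)%R ->
  \int[mu]_x (f x ^+ 2)%:E < +oo -> \int[mu]_x (f x)%:E < +oo.
Proof.
move=> mf f0 f2oo.
apply: (@le_lt_trans _ _ (\int[mu]_x ((f x ^+ 2)%:E + 1))).
  apply: ge0_le_integral => //.
  - by move=> x _; rewrite lee_fin.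
  - exact/measurable_EFinP.
  - by apply: emeasurable_funD => //; apply/measurable_EFinP/measurable_funX.
  - by move=> x _; rewrite -EFinD lee_fin; have := f0 x; nra.
rewrite ge0_integralD//; first last.
- by apply/measurable_EFinP/measurable_funX.
- by move=> x _; rewrite lee_fin sqr_ge0.
by rewrite integral_cst//= probability_setT mule1 lte_add_pinfty// ltry.
Qed.

Variable k : T -> T -> R.
Hypothesis hk : comparison_weight k.

Let mk : measurable_fun setT (fun z : T * T => k z.1 z.2).
Proof. by case: hk. Qed.

Let mk' : measurable_fun setT (fun z : T * T => k z.2 z.1).
Proof.
apply: (@measurableT_comp _ _ _ _ (T * T)%type _ (fun z : T * T => k z.1 z.2) _
  (fun z : T * T => (z.2, z.1)) mk).
exact: measurable_swap. Qed.

Let k0 y x : (0 <= k y x)%R.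
Proof. by case: hk => _ + _ _; exact. Qed.

Let kC y x : (k y x + k x y = 1)%R.
Proof. by case: hk => _ _ + _; exact. Qed.

Let k_le1 y x : (k y x <= 1)%R.
Proof. by rewrite -(kC y x) lerDl. Qed.

Let mkl x : measurable_fun setT (k ^~ x).
Proof.
exact: (measurableT_comp mk (measurable_pair2 x)).
Qed.

Let mfk (f : T -> R) x : measurable_fun setT f ->
  measurable_fun setT (fun y => (f y * k y x)%:E).
Proof. by move=> mf; apply/measurable_EFinP/measurable_funM. Qed.

Lemma measurable_weighted_mean (f : T -> R) :
  measurable_fun setT f -> measurable_fun setT (weighted_mean mu k f).
Proof.
move=> mf.
apply: (@measurable_section_integral _ _ T T R mu
  (fun z => (f z.2 * k z.2 z.1)%:E)).
apply/measurable_EFinP/measurable_funM; first exact: measurableT_comp.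
exact: mk'.
Qed.

Lemma weighted_mean_ge0 (f : T -> R) x :
  (forall y, 0 <= f y)%R -> 0 <= weighted_mean mu k f x.
Proof.
by move=> f0; apply: integral_ge0 => y _; rewrite lee_fin mulr_ge0.
Qed.

Lemma weighted_mean_le_integral (f : T -> R) x :
  measurable_fun setT f -> (forall y, 0 <= f y)%R ->
  weighted_mean mu k f x <= \int[mu]_y (f y)%:E.
Proof.
move=> mf f0; apply: ge0_le_integral => //.
- by move=> y _; rewrite lee_fin mulr_ge0.
- exact: mfk.
- exact/measurable_EFinP.
- by move=> y _; rewrite lee_fin ler_piMr.
Qed.

Lemma abs_weighted_mean_le (f : T -> R) x : measurable_fun setT f ->
  `|weighted_mean mu k f x| <= weighted_mean mu k (fun y => `|f y|%R) x.
Proof.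
move=> mf; apply: le_trans (le_abse_integral _ measurableT (mfk _ mf)) _.
rewrite le_eqVlt; apply/orP; left; apply/eqP; apply: eq_integral => y _ /=.
by rewrite normrM (ger0_norm (k0 y x)).
Qed.

(** Exchanging the two variables replaces the weight [k y x] by [k x y], and the
    two weights add up to 1. So twice the left-hand side is the unweighted
    double integral, a product. *)
Lemma weighted_mean_symmetrization (f : T -> R) :
  measurable_fun setT f -> (forall y, 0 <= f y)%R ->
  \int[mu]_x (weighted_mean mu k f x * (f x)%:E) =
  (2^-1)%:E * (\int[mu]_x (f x)%:E * \int[mu]_x (f x)%:E).
Proof.
move=> mf f0.
pose G (z : T * T) := (f z.2 * k z.2 z.1 * f z.1)%:E.
pose G' (z : T * T) := (f z.1 * k z.1 z.2 * f z.2)%:E.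
have mf1 : measurable_fun setT (fun z : T * T => f z.1) by exact: measurableT_comp.
have mf2 : measurable_fun setT (fun z : T * T => f z.2) by exact: measurableT_comp.
have mG : measurable_fun setT G.
  by apply/measurable_EFinP/measurable_funM => //; exact: measurable_funM.
have mG' : measurable_fun setT G'.
  by apply/measurable_EFinP/measurable_funM => //; exact: measurable_funM.
have G0 z : 0 <= G z by rewrite lee_fin !mulr_ge0.
have G'0 z : 0 <= G' z by rewrite lee_fin !mulr_ge0.
have GE : \int[mu]_x (weighted_mean mu k f x * (f x)%:E) =
    \int[mu]_x \int[mu]_y G (x, y).
  apply: eq_integral => x _; rewrite -ge0_integralZr//.
  - exact: mfk.
  - by move=> y _; rewrite lee_fin mulr_ge0.
  - by rewrite lee_fin.
have GG' : \int[mu]_x \int[mu]_y G (x, y) = \int[mu]_x \int[mu]_y G' (x, y).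
  exact: (fubini_tonelli G mG G0).
have GD : \int[mu]_x \int[mu]_y G (x, y) + \int[mu]_x \int[mu]_y G' (x, y) =
    \int[mu]_x (f x)%:E * \int[mu]_x (f x)%:E.
  have mfE : measurable_fun setT (EFin \o f) by exact/measurable_EFinP.
  have fE0 x : 0 <= (EFin \o f) x by rewrite lee_fin.
  rewrite -(ge0_iterated_integralD _ _ mG mG' G0 G'0).
  rewrite -(ge0_iterated_integralM _ _ mfE mfE fE0 fE0).
  apply: eq_integral => x _; apply: eq_integral => y _.
  rewrite /G /G' /= -EFinM -EFinD; congr _%:E.
  by have /(congr1 (fun t => f x * f y * t)%R) := kC y x; rewrite mulr1 => <-; ring.
rewrite -GD GE -GG'; move: (\int[mu]_x _) => [r| |] /=.
- by rewrite -EFinD -EFinM; congr _%:E; field.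
- by rewrite mulry gtr0_sg ?invr_gt0// mul1e.
- by rewrite mulrNy gtr0_sg ?invr_gt0// mul1e.
Qed.

(** By symmetrization the square of the integral of [f] vanishes. *)
Lemma ae_eq0_of_weighted_mean_eq0 (f : T -> R) :
  measurable_fun setT f -> (forall y, 0 <= f y)%R ->
  {ae mu, forall x, weighted_mean mu k f x = 0} -> {ae mu, forall x, f x = 0%R}.
Proof.
move=> mf f0 Af0.
have := weighted_mean_symmetrization mf f0.
rewrite (ge0_ae_eq_integral (g := cst 0))//; first last.
- by apply: filterS Af0 => x /= -> _; rewrite mul0e.
- by move=> x _; rewrite mule_ge0 ?lee_fin// weighted_mean_ge0.
- apply: emeasurable_funM; first exact: measurable_weighted_mean.
  exact/measurable_EFinP.
rewrite integral0 => /esym/eqP.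
rewrite mule_eq0 eqe invr_eq0 pnatr_eq0/= mule_eq0 orbb => /eqP intf0.
have : \int[mu]_x `|(f x)%:E| = 0.
  by rewrite -intf0; apply: eq_integral => x _; rewrite gee0_abs ?lee_fin.
have mfE : measurable_fun setT (EFin \o f) by exact/measurable_EFinP.
move=> /(ae_eq_integral_abs mu measurableT mfE).
by apply: filterS => x /= /(_ I) [].
Qed.

(** The zero set of a weighted mean is an initial segment of the preorder: if
    [x] comes before [x0], every [y] weighted at [x] is weighted at [x0]. *)
Lemma weighted_mean_eq0_trans (f : T -> R) x0 x :
  measurable_fun setT f -> (forall y, 0 <= f y)%R ->
  (0 < k x x0)%R -> weighted_mean mu k f x0 = 0 -> weighted_mean mu k f x = 0.
Proof.
move=> mf f0 kx Af0.
have fk0 z y : 0 <= (f y * k y z)%:E by rewrite lee_fin mulr_ge0.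
have : \int[mu]_y `|(f y * k y x0)%:E| = 0.
  by rewrite -[RHS]Af0; apply: eq_integral => y _; rewrite gee0_abs.
move=> /(ae_eq_integral_abs mu measurableT (mfk x0 mf)) fx0.
rewrite /weighted_mean (ge0_ae_eq_integral (g := cst 0)) ?integral0//.
  exact: mfk.
apply: filterS fx0 => y /= /(_ I) [/eqP].
rewrite mulf_eq0 => /orP[/eqP-> _|/eqP kyx0 _].
  by rewrite mul0r.
have [->|] := eqVneq (k y x) 0%R; first by rewrite mulr0.
rewrite neq_lt ltNge k0 /= => kyx.
case: hk => _ _ _ /(_ _ _ _ kyx kx).
by rewrite kyx0 ltxx.
Qed.

Lemma weighted_mean_posneg (f : T -> R) x :
  weighted_mean mu k f x = weighted_mean mu k f^\+%R x - weighted_mean mu k f^\-%R x.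
Proof.
rewrite /weighted_mean integralE; congr (_ - _); apply: eq_integral => y _.
- by rewrite funeposE -EFin_max /funrpos maxr_pMl// mul0r.
- by rewrite funenegE -EFinN -EFin_max /funrneg maxr_pMl// mul0r mulNr.
Qed.

Lemma weighted_mean_norm (f : T -> R) x : measurable_fun setT f ->
  weighted_mean mu k (fun y => `|f y|%R) x =
  weighted_mean mu k f^\+%R x + weighted_mean mu k f^\-%R x.
Proof.
move=> mf; rewrite /weighted_mean -ge0_integralD//.
- apply: eq_integral => y _; rewrite -EFinD -mulrDl; congr (_ * _)%:E.
  by have /(congr1 (fun g => g y)) := funrposDneg f.
- by move=> y _; rewrite lee_fin mulr_ge0.
- exact/mfk/measurable_funrpos.
- by move=> y _; rewrite lee_fin mulr_ge0.
- exact/mfk/measurable_funrneg.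
Qed.

(** Equality in the triangle inequality at [x] forces one of the two weighted
    means [a] and [b] of the positive and negative parts to vanish at [x]. Both
    zero sets are initial segments, hence nested; so the same one of [a] and [b]
    vanishes almost everywhere. *)
Lemma one_signed_of_abs_weighted_mean_eq (f : T -> R) :
  measurable_fun setT f -> \int[mu]_x `|f x|%:E < +oo ->
  {ae mu, forall x,
    `|weighted_mean mu k f x| = weighted_mean mu k (fun y => `|f y|%R) x} ->
  {ae mu, forall x, f^\+%R x = 0%R} \/ {ae mu, forall x, f^\-%R x = 0%R}.
Proof.
move=> mf foo Aabs.
have mfp := measurable_funrpos mf; have mfn := measurable_funrneg mf.
set a := weighted_mean mu k f^\+%R; set b := weighted_mean mu k f^\-%R.
have a0 x : 0 <= a x by exact: weighted_mean_ge0.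
have b0 x : 0 <= b x by exact: weighted_mean_ge0.
have aboo x : a x + b x < +oo.
  rewrite -weighted_mean_norm//; apply: le_lt_trans foo.
  by apply: weighted_mean_le_integral => //; exact: measurableT_comp.
have abS x : `|weighted_mean mu k f x| = weighted_mean mu k (fun y => `|f y|%R) x ->
    a x = 0 \/ b x = 0.
  rewrite weighted_mean_posneg weighted_mean_norm// -/a -/b.
  move: (a0 x) (b0 x) (aboo x); case: (a x) => [r| |]; case: (b x) => [s| |] //=.
  rewrite !lee_fin => r0 s0 _ [] /eqP.
  have [rs|/ltW sr] := leP s r.
    rewrite ger0_norm ?subr_ge0// => /eqP H; right; congr _%:E; lra.
  by rewrite ler0_norm ?subr_le0// => /eqP H; left; congr _%:E; lra.
(* A point [x0] in the equality set with [a x0 <> 0] decides which of the two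
   vanishes: [b] is zero before [x0], and [a] is nonzero after [x0]. *)
have [[x0 [gx0 ax0]]|nx] := pselect (exists x0,
    `|weighted_mean mu k f x0| = weighted_mean mu k (fun y => `|f y|%R) x0
    /\ a x0 <> 0); last first.
  left; apply: ae_eq0_of_weighted_mean_eq0 => //.
  apply: filterS Aabs => x gx; apply: contrapT => ax; apply: nx.
  by exists x.
right; apply: ae_eq0_of_weighted_mean_eq0 => //.
have bx0 : b x0 = 0 by case: (abS _ gx0).
apply: filterS Aabs => x gx.
have [kx|kx] := ltP 0%R (k x x0).
  exact: weighted_mean_eq0_trans kx bx0.
have kx0 : (0 < k x0 x)%R by have := kC x x0; lra.
case: (abS _ gx) => // ax.
by case: ax0; exact: weighted_mean_eq0_trans kx0 ax.
Qed.

Lemma abs_weighted_mean_of_one_signed (f : T -> R) x : measurable_fun setT f ->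
  {ae mu, forall x, f^\+%R x = 0%R} \/ {ae mu, forall x, f^\-%R x = 0%R} ->
  `|weighted_mean mu k f x| = weighted_mean mu k (fun y => `|f y|%R) x.
Proof.
move=> mf.
have wm0 (g : T -> R) : measurable_fun setT g -> (forall y, 0 <= g y)%R ->
    {ae mu, forall x, g x = 0%R} -> weighted_mean mu k g x = 0.
  move=> mg g0 ag; rewrite /weighted_mean.
  rewrite (ge0_ae_eq_integral (g := cst 0)) ?integral0//.
  - exact: mfk.
  - by move=> y _; rewrite lee_fin mulr_ge0.
  - by apply: filterS ag => y /= -> _; rewrite mul0r.
rewrite weighted_mean_posneg weighted_mean_norm//.
case=> [/wm0 ->//|/wm0 ->//].
- by rewrite sub0e abseN add0e gee0_abs// weighted_mean_ge0.
- exact: measurable_funrpos.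
- by rewrite sube0 adde0 gee0_abs// weighted_mean_ge0.
- exact: measurable_funrneg.
Qed.

(** * The chain of inequalities for an abstract weight *)

Section chain.
Variable f : T -> R.
Hypothesis mf : measurable_fun setT f.

Let A := \int[mu]_x `|weighted_mean mu k f x * (f x)%:E|.
Let B := \int[mu]_x (weighted_mean mu k (fun y => `|f y|%R) x * `|f x|%:E).
Let S := \int[mu]_x (f x ^+ 2)%:E.

Let mnf : measurable_fun setT (fun x => `|f x|%R).
Proof. exact: measurableT_comp. Qed.

Let mB : measurable_fun setT
  (fun x => weighted_mean mu k (fun y => `|f y|%R) x * `|f x|%:E).
Proof.
apply: emeasurable_funM; first exact: measurable_weighted_mean.
exact/measurable_EFinP.
Qed.

Let mA : measurable_fun setT (fun x => `|weighted_mean mu k f x * (f x)%:E|).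
Proof.
apply: measurableT_comp => //.
apply: emeasurable_funM; first exact: measurable_weighted_mean.
exact/measurable_EFinP.
Qed.

Let AB_le x : `|weighted_mean mu k f x * (f x)%:E| <=
  weighted_mean mu k (fun y => `|f y|%R) x * `|f x|%:E.
Proof. by rewrite abseM lee_wpmul2r// abs_weighted_mean_le. Qed.

Let S_norm : S = \int[mu]_x (`|f x| ^+ 2)%:E.
Proof. by apply: eq_integral => x _; rewrite real_normK ?num_real. Qed.

Let BE : B = (2^-1)%:E * (\int[mu]_x `|f x|%:E * \int[mu]_x `|f x|%:E).
Proof. exact: weighted_mean_symmetrization. Qed.

Let S_lty_fin : S < +oo -> exists m : R, \int[mu]_x `|f x|%:E = m%:E.
Proof.
rewrite S_norm => /integral_lty_of_sqr noo.
exists (fine (\int[mu]_x `|f x|%:E)); rewrite fineK// ge0_fin_numE ?noo//.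
by apply: integral_ge0 => x _; rewrite lee_fin.
Qed.

Lemma abs_weighted_mean_integral_le : A <= B.
Proof.
exact: ge0_le_integral.
Qed.

Lemma weighted_mean_abs_integral_le : B <= (2^-1)%:E * S.
Proof.
have [/S_lty_fin[m Em]|] := ltP S +oo; last first.
  by rewrite leye_eq => /eqP ->; rewrite mulry gtr0_sg ?invr_gt0// mul1e leey.
rewrite BE lee_pmul2l ?lte_fin ?invr_gt0// Em.
rewrite S_norm -(second_moment_identity mnf _ Em)//.
rewrite -EFinM -expr2 leeDr// integral_ge0// => x _.
by rewrite lee_fin sqr_ge0.
Qed.

(** Equality in the second place makes [|f|] constant, equality in the first
    place makes [f] one-signed. *)
Lemma ae_constant_of_chain_eq :
  equal_throughout A B ((2^-1)%:E * S) -> exists c, {ae mu, forall x, f x = c}.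
Proof.
case=> eAB eBC Cfin.
have Soo : S < +oo.
  rewrite ltNge leye_eq; apply/eqP => Soo; move: Cfin.
  by rewrite Soo mulry gtr0_sg ?invr_gt0// mul1e.
have [m Em] := S_lty_fin Soo.
have fm : {ae mu, forall x, `|f x|%R = m}.
  have mmS : (m ^+ 2)%:E = S.
    move: eBC; rewrite BE Em -EFinM -expr2; move: Soo; case: S => [s| |] //=.
      move=> _; rewrite -!EFinM => -[] /(congr1 (fun t => 2 * t)%R) h.
      by congr _%:E; lra.
    by rewrite mulrNy gtr0_sg ?invr_gt0// mul1e.
  have := second_moment_identity mnf (fun x => normr_ge0 (f x)) Em.
  rewrite -S_norm -mmS => /(congr1 (fun t => t - (m ^+ 2)%:E)).
  rewrite addeK// subee// => int0.
  have mv : measurable_fun setT (fun x => ((`|f x| - m) ^+ 2)%:E).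
    by apply/measurable_EFinP/measurable_funX; exact: measurable_funB.
  have : \int[mu]_x `|((`|f x| - m) ^+ 2)%:E| = 0.
    by rewrite -int0; apply: eq_integral => x _; rewrite gee0_abs// lee_fin sqr_ge0.
  move=> /(ae_eq_integral_abs mu measurableT mv); apply: filterS => x /= /(_ I).
  by move=> [] /eqP; rewrite sqrf_eq0 subr_eq0 => /eqP.
have [m0|m0] := eqVneq m 0%R.
  by exists 0%R; apply: filterS fm => x; rewrite m0 => /normr0P/eqP.
have Noo x : weighted_mean mu k (fun y => `|f y|%R) x < +oo.
  apply: le_lt_trans (weighted_mean_le_integral x mnf _) _ => //.
  by rewrite Em ltry.
have eqx : {ae mu, forall x, `|weighted_mean mu k f x * (f x)%:E| =
    weighted_mean mu k (fun y => `|f y|%R) x * `|f x|%:E}.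
  apply: ae_eq_of_le_integral_eq => //.
  - by move=> x; rewrite lte_mul_pinfty ?ltry ?ge0_fin_numE ?weighted_mean_ge0.
  - by rewrite -/B BE Em -!EFinM ltry.
have absx : {ae mu, forall x,
    `|weighted_mean mu k f x| = weighted_mean mu k (fun y => `|f y|%R) x}.
  apply: filterS2 eqx fm => x + fxm; rewrite abseM /= fxm.
  move: (abs_weighted_mean_le x mf) (Noo x).
  case: (weighted_mean mu k f x) => [r| |];
    case: (weighted_mean mu k _ x) => [s| |] //=.
  by move=> _ _ [] /(mulIf m0) ->.
have [|fp|fn] := one_signed_of_abs_weighted_mean_eq mf _ absx.
- by rewrite Em ltry.
- exists (- m)%R; apply: filterS2 fp fm => x fp <-.
  have /(congr1 (fun g => g x)) := funrposBneg f.
  have /(congr1 (fun g => g x)) := funrposDneg f.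
  by rewrite !fctE /= fp => <- <-; rewrite sub0r add0r.
- exists m; apply: filterS2 fn fm => x fn <-.
  have /(congr1 (fun g => g x)) := funrposBneg f.
  have /(congr1 (fun g => g x)) := funrposDneg f.
  by rewrite !fctE /= fn => <- <-; rewrite subr0 addr0.
Qed.

Lemma chain_eq_of_ae_constant c :
  {ae mu, forall x, f x = c} -> equal_throughout A B ((2^-1)%:E * S).
Proof.
move=> fc.
have one : {ae mu, forall x, f^\+%R x = 0%R} \/ {ae mu, forall x, f^\-%R x = 0%R}.
  have [c0|/ltW c0] := leP 0%R c.
    by right; apply: filterS fc => x fx; rewrite /funrneg fx max_r// oppr_le0.
  by left; apply: filterS fc => x fx; rewrite /funrpos fx max_r.
have SE : S = (c ^+ 2)%:E.
  rewrite /S (ge0_ae_eq_integral (g := cst (c ^+ 2)%:E))//.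
  - by rewrite integral_cst//= probability_setT mule1.
  - by apply/measurable_EFinP/measurable_funX.
  - by move=> x _; rewrite lee_fin sqr_ge0.
  - by move=> x _; rewrite lee_fin sqr_ge0.
  - by apply: filterS fc => x /= -> _.
have mE : \int[mu]_x `|f x|%:E = `|c|%:E.
  rewrite (ge0_ae_eq_integral (g := cst `|c|%:E))//.
  - by rewrite integral_cst//= probability_setT mule1.
  - exact/measurable_EFinP.
  - by move=> x _; rewrite lee_fin.
  - by apply: filterS fc => x /= -> _.
split.
- apply: eq_integral => x _.
  by rewrite abseM abs_weighted_mean_of_one_signed.
- by rewrite BE SE mE -!EFinM -expr2 real_normK ?num_real.
- by rewrite SE -EFinM.
Qed.

End chain.
End weighted_mean.

(** * The weights of the usual order and its converse *)

Lemma measurable_bool_natr d (T : measurableType d) (R : realType)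
    (b : T -> bool) :
  measurable_fun setT b -> measurable_fun setT (fun x => (b x)%:R%R : R).
Proof.
move=> mb; have -> : (fun x => (b x)%:R%R : R) = (fun x => if b x then 1 else 0)%R.
  by apply/funext => x; case: (b x).
exact: measurable_fun_ifT.
Qed.

Lemma weight_lt_gt0 (R : realType) (y x : R) :
  (0 < weight_lt y x)%R = (y <= x)%R.
Proof.
rewrite /weight_lt; case: (ltgtP y x) => _ /=.
- by rewrite mulr0 addr0 ltr01.
- by rewrite mulr0 addr0 ltxx.
- by rewrite mulr1 add0r invr_gt0 ltr0n.
Qed.

Lemma weight_lt_comparison (R : realType) :
  comparison_weight (T := measurableTypeR R) (@weight_lt R).
Proof.
split.
- have m1 : measurable_fun (T := (measurableTypeR R * measurableTypeR R)%type)
    setT (fun z => z.1 : R) by exact: measurable_fst.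
  have m2 : measurable_fun (T := (measurableTypeR R * measurableTypeR R)%type)
    setT (fun z => z.2 : R) by exact: measurable_snd.
  apply: measurable_funD.
    exact/measurable_bool_natr/measurable_fun_ltr.
  apply: measurable_funM => //.
  exact/measurable_bool_natr/measurable_fun_eqr.
- by move=> y x; rewrite /weight_lt addr_ge0// mulr_ge0.
- move=> y x; rewrite /weight_lt eq_sym.
  by case: ltgtP => _ /=; lra.
- by move=> y x z; rewrite !weight_lt_gt0; exact: le_trans.
Qed.

Lemma weight_gtE (R : realType) (y x : R) : weight_gt y x = weight_lt x y.
Proof. by rewrite /weight_gt /weight_lt eq_sym. Qed.

Lemma comparison_weight_flip d (T : measurableType d) (R : realType)
    (k : T -> T -> R) :
  comparison_weight k -> comparison_weight (fun y x => k x y).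
Proof.
move=> [mk k0 kC ktr]; split => //.
- apply: (@measurableT_comp _ _ _ _ (T * T)%type _ (fun z : T * T => k z.1 z.2) _
    (fun z : T * T => (z.2, z.1)) mk).
  exact: measurable_swap.
- by move=> y x z xy zx; exact: ktr zx xy.
Qed.

Lemma weight_gt_comparison (R : realType) :
  comparison_weight (T := measurableTypeR R) (@weight_gt R).
Proof.
have -> : @weight_gt R = (fun y x => weight_lt x y).
  by apply/funext => y; apply/funext => x; exact: weight_gtE.
exact: comparison_weight_flip (weight_lt_comparison R).
Qed.

(** * Passing to the law on the real line *)

Section transfer.
Context (R : realType) (d : measure_display) (T : measurableType d).
Variables (P : probability T R) (F : cumulativeBounded (0 : R) (1 : R)).

Local Notation lsF := (lebesgue_stieltjes_measure F).

(** Two measures on the line with the same values on half-open intervals agree.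
    The Lebesgue-Stieltjes measure lives on [measurableTypeR R], whose sigma-algebra
    is that of [R] under another display, so [X] is repackaged with this target. *)
Lemma lebesgue_stieltjes_of_cdf (X : {RV P >-> R}) (A : set R) :
  has_cdf X F -> measurable A -> lsF A = P (X @^-1` A).
Proof.
move=> cdfX mA.
have mX : @measurable_fun _ _ T (measurableTypeR R) setT X.
  exact: (@measurable_funPT _ _ _ _ X).
pose X' : {mfun T >-> measurableTypeR R} := HB.pack (X : T -> measurableTypeR R)
  (isMeasurableFun.Build _ _ _ _ _ mX).
have XF x : P (X @^-1` `]-oo, x]) = (F x)%:E by exact: cdfX.
apply: (@lebesgue_stieltjes_measure_unique R F (distribution P X')) => //.
move=> I [[a b]] /= _ <-.
rewrite /lebesgue_stieltjes_measure /measure_extension/=.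
rewrite measurable_mu_extE/=; last exact: is_ocitv.
have [ab | ba] := leP a b; last first.
  by rewrite set_itv_ge ?wlength0 ?measure0// bnd_simp -leNgt ltW.
rewrite wlength_itv_bnd// EFinB -!XF /distribution /pushforward /=.
have -> : `]a, b]%classic = `]-oo, b] `\` `]-oo, a].
  by rewrite -[RHS]setCK setCD setCitvl setUC -[LHS]setCK setCitv.
rewrite (_ : X @^-1` (_ `\` _) = (X @^-1` `]-oo, b]) `\` (X @^-1` `]-oo, a]))//.
rewrite measureD//; last 3 first.
- exact: measurable_funPTI.
- exact: measurable_funPTI.
- by rewrite -ge0_fin_numE// fin_num_measure//; exact: measurable_funPTI.
rewrite setIidr//; apply: preimage_subset; exact: subset_itvl.
Qed.

Lemma ge0_integral_lebesgue_stieltjes (X : {RV P >-> R}) (g : R -> \bar R) :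
  has_cdf X F -> measurable_fun (T := measurableTypeR R) setT g ->
  (forall x, 0 <= g x) ->
  \int[lsF]_x g x = \int[P]_w g (X w).
Proof.
move=> cdfX mg g0.
have mX : @measurable_fun _ _ T (measurableTypeR R) setT X.
  exact: (@measurable_funPT _ _ _ _ X).
rewrite -[RHS](@ge0_integral_pushforward _ _ T (measurableTypeR R) R
  X mX P setT g)//.
by apply: eq_measure_integral => A mA _; exact: lebesgue_stieltjes_of_cdf.
Qed.

(** Independence says that the joint law agrees with the product measure on
    rectangles, which determine it; Tonelli gives the iterated integral. *)
Lemma ge0_integral_joint (X Y : {RV P >-> R}) (g : R * R -> \bar R) :
  independent_RVs X Y -> has_cdf X F -> has_cdf Y F ->
  measurable_fun (T := (measurableTypeR R * measurableTypeR R)%type) setT g ->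
  (forall z, 0 <= g z) ->
  \int[P]_w g (X w, Y w) = \int[lsF]_x \int[lsF]_y g (x, y).
Proof.
move=> indep cdfX cdfY mg g0.
have mXY : @measurable_fun _ _ T (measurableTypeR R * measurableTypeR R)%type
    setT (fun w => (X w, Y w)).
  by apply: measurable_fun_pair;
    [exact: (@measurable_funPT _ _ _ _ X)|exact: (@measurable_funPT _ _ _ _ Y)].
rewrite -(fubini_tonelli1 (m1 := lsF) (m2 := lsF) g mg g0).
rewrite -(@ge0_integral_pushforward _ _ T
  (measurableTypeR R * measurableTypeR R)%type R _ mXY P setT g)//.
apply: eq_measure_integral => A mA _.
apply/esym/product_measure_unique => // B C mB mC.
transitivity (P (X @^-1` B) * P (Y @^-1` C)); first exact: indep.
by congr (_ * _); apply/esym; exact: lebesgue_stieltjes_of_cdf.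
Qed.

End transfer.

(** * The chain for the random variables *)

Section chain_transfer.
Context (R : realType) (d : measure_display) (T : measurableType d).
Variables (P : probability T R) (X Y : {RV P >-> R}).
Variables (F : cumulativeBounded (0 : R) (1 : R)) (psi : R -> R).
Hypothesis indepXY : independent_RVs X Y.
Hypothesis cdfX : has_cdf X F.
Hypothesis cdfY : has_cdf Y F.
Hypothesis mpsi : measurable_fun [set: R] psi.

Local Notation E := (measurableTypeR R).
Let mu : probability E R := lebesgue_stieltjes_measure F.

Let mpsi' : measurable_fun [set: E] psi.
Proof. exact: mpsi. Qed.

Variable k : R -> R -> R.
Hypothesis hk : comparison_weight (T := E) k.

Lemma mean_abs_condE : mean_abs_cond X F psi k =
  \int[mu]_x `|weighted_mean mu k psi x * (psi x)%:E|.
Proof.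
rewrite (ge0_integral_lebesgue_stieltjes (F := F) cdfX)//.
apply: measurableT_comp => //.
apply: emeasurable_funM; first exact: measurable_weighted_mean.
exact/measurable_EFinP.
Qed.

Lemma mean_abs_prodE : mean_abs_prod X Y psi k =
  \int[mu]_x (weighted_mean mu k (fun y => `|psi y|%R) x * `|psi x|%:E).
Proof.
case: (hk) => mk k0 _ _.
pose g (z : E * E) := (`|psi z.1 * psi z.2| * k z.2 z.1)%:E.
have mnpsi : measurable_fun [set: E] (fun y => `|psi y|%R).
  exact: measurableT_comp.
have m1 : measurable_fun [set: E * E] (fun z : E * E => psi z.1).
  by apply: measurableT_comp => //; exact: measurable_fst.
have m2 : measurable_fun [set: E * E] (fun z : E * E => psi z.2).
  by apply: measurableT_comp => //; exact: measurable_snd.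
have mg : measurable_fun [set: E * E] g.
  apply/measurable_EFinP/measurable_funM.
    by apply: measurableT_comp => //; exact: measurable_funM.
  by case: (comparison_weight_flip hk).
rewrite /mean_abs_prod unlock.
rewrite (ge0_integral_joint (g := g) indepXY cdfX cdfY)//; last first.
  by move=> z; rewrite lee_fin mulr_ge0.
apply: eq_integral => x _.
rewrite -ge0_integralZr//.
- apply: eq_integral => y _; rewrite /g /= -EFinM normrM; congr _%:E; ring.
- apply/measurable_EFinP/measurable_funM => //.
  exact: (measurableT_comp mk (measurable_pair2 x)).
- by move=> y _; rewrite lee_fin mulr_ge0.
Qed.

Lemma half_mean_sqE : half_mean_sq X psi =
  (2^-1)%:E * \int[mu]_x (psi x ^+ 2)%:E.
Proof.
rewrite /half_mean_sq unlock; congr (_ * _).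
rewrite (ge0_integral_lebesgue_stieltjes (F := F) cdfX)//.
- by apply/measurable_EFinP/measurable_funX.
- by move=> x; rewrite lee_fin sqr_ge0.
Qed.

Lemma comparison_weight_chain :
  [/\ mean_abs_cond X F psi k <= mean_abs_prod X Y psi k,
      mean_abs_prod X Y psi k <= half_mean_sq X psi &
      equal_throughout (mean_abs_cond X F psi k) (mean_abs_prod X Y psi k)
        (half_mean_sq X psi) <-> ae_constant F psi].
Proof.
rewrite mean_abs_condE mean_abs_prodE half_mean_sqE; split.
- exact: abs_weighted_mean_integral_le.
- exact: weighted_mean_abs_integral_le.
- split; first exact: ae_constant_of_chain_eq.
  by case=> c; exact: chain_eq_of_ae_constant.
Qed.

End chain_transfer.

Theorem theorem2p1 (R : realType) (d : measure_display) (T : measurableType d)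
    (P : probability T R) (X Y : {RV P >-> R})
    (F : cumulativeBounded (0 : R) (1 : R)) (psi : R -> R)
    (indepXY : independent_RVs X Y)
    (cdfX : has_cdf X F) (cdfY : has_cdf Y F)
    (mpsi : measurable_fun [set: R] psi) :
  (mean_abs_cond X F psi (@weight_lt R) <= mean_abs_prod X Y psi (@weight_lt R)
   /\ mean_abs_prod X Y psi (@weight_lt R) <= half_mean_sq X psi)
  /\ (mean_abs_cond X F psi (@weight_gt R) <= mean_abs_prod X Y psi (@weight_gt R)
   /\ mean_abs_prod X Y psi (@weight_gt R) <= half_mean_sq X psi)
  /\ (equal_throughout (mean_abs_cond X F psi (@weight_lt R))
        (mean_abs_prod X Y psi (@weight_lt R)) (half_mean_sq X psi)
      <-> ae_constant F psi)
  /\ (equal_throughout (mean_abs_cond X F psi (@weight_gt R))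
        (mean_abs_prod X Y psi (@weight_gt R)) (half_mean_sq X psi)
      <-> ae_constant F psi).
Proof.
have [lt1 lt2 lt_eq] :=
  comparison_weight_chain indepXY cdfX cdfY mpsi (weight_lt_comparison R).
have [gt1 gt2 gt_eq] :=
  comparison_weight_chain indepXY cdfX cdfY mpsi (weight_gt_comparison R).
by [].
Qed.
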